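(* If $\tau \in \{1200,1220,1230\}$, then $$f_\tau(x)=\frac{1-7x+17x^2-16x^3+5x^4-x^5}{(1-2x)(1-3x+x^2)^2}$$ as formal power series in $x$, where $f_\tau(x)=\sum_{n\ge 0} b_n(\tau)x^n$ and $b_n(\tau)$ is the number of ascent sequences of length $n$ that avoid both patterns $021$ and $\tau$.
   Context: For a finite sequence $w=w_1\cdots w_n$ of integers, $\mathrm{asc}(w)$ is the number of indices $1\le i\le n-1$ with $w_i<w_{i+1}$. An ascent sequence of length $n\ge 1$ is a sequence $a_1\cdots a_n$ of non-negative integers such that $a_1=0$ and $a_i\le \mathrm{asc}(a_1\cdots a_{i-1})+1$ for $1<i\le n$; there is exactly one (empty) ascent sequence of length $0$. A sequence $\pi=\pi_1\cdots\pi_n$ contains a pattern $\tau=\tau_1\cdots\tau_m$ if there are indices $1\le i_1<\cdots<i_m\le n$ such that for all $j,k\in\{1,\dots,m\}$: $\pi_{i_j}<\pi_{i_k}$ iff $\tau_j<\tau_k$, and $\pi_{i_j}=\pi_{i_k}$ iff $\tau_j=\tau_k$; otherwise $\pi$ avoids $\tau$. For a pattern $\tau$, $B_n(\tau)$ is the set of ascent sequences of length $n$ avoiding both $021$ and $\tau$ (with $B_0(\tau)$ consisting of the empty sequence), and $b_n(\tau)=|B_n(\tau)|$. *)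

(* Defs.v *)
From HB Require Import structures.
From mathcomp Require Import all_boot all_order all_algebra.

Set Implicit Arguments.
Unset Strict Implicit.
Unset Printing Implicit Defensive.

Import GRing.Theory.

(* Words are 0-indexed: the letter w_i of the usual notation is [nth 0 w i.-1]. *)

Definition asc (w : seq nat) : nat :=
  count (fun i => nth 0 w i < nth 0 w i.+1) (iota 0 (size w).-1).

Definition ascent_seq (a : seq nat) : bool :=
  [forall i : 'I_(size a),
     if val i == 0 then nth 0 a i == 0
     else nth 0 a i <= asc (take i a) + 1].

Definition contains (p t : seq nat) : bool :=
  [exists f : {ffun 'I_(size t) -> 'I_(size p)},
    [forall j : 'I_(size t), forall k : 'I_(size t),
      [&& (j < k) ==> (f j < f k),
          (nth 0 p (f j) < nth 0 p (f k)) == (nth 0 t j < nth 0 t k)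
        & (nth 0 p (f j) == nth 0 p (f k)) == (nth 0 t j == nth 0 t k)]]].

Definition avoids (p t : seq nat) : bool := ~~ contains p t.

(* The letters of an ascent sequence of length n are all < n (lemma
   [ascent_seq_lt]), so length-n tuples over 'I_n are enough to enumerate them;
   [mem_B] and [uniq_B] state that no sequence is missed or counted twice. *)
Definition B (n : nat) (t : seq nat) : {set n.-tuple 'I_n} :=
  [set a : n.-tuple 'I_n |
    let w := map val a in
    [&& ascent_seq w, avoids w [:: 0; 2; 1] & avoids w t]].

Definition b (n : nat) (t : seq nat) : nat := #|B n t|.

Lemma asc_le (w : seq nat) : asc w <= (size w).-1.
Proof. by rewrite /asc (leq_trans (count_size _ _)) // size_iota. Qed.

Lemma ascent_seq_lt (a : seq nat) :
  ascent_seq a -> all (fun x => x < size a) a.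
Proof.
move=> /forallP Ha; apply/(all_nthP 0) => i Hi.
have := Ha (Ordinal Hi) => /=.
case: eqP => [-> /eqP -> | /eqP i0 Hle]; first exact: leq_ltn_trans Hi.
apply: (leq_ltn_trans _ Hi); apply: (leq_trans Hle).
have := asc_le (take i a); rewrite size_take_min (minn_idPl (ltnW Hi)) => H.
by rewrite addn1 (leq_ltn_trans H) // ltn_predL lt0n.
Qed.

Lemma mem_B (n : nat) (t s : seq nat) :
  (s \in [seq map val (tval a) | a in B n t]) =
  [&& size s == n, ascent_seq s, avoids s [:: 0; 2; 1] & avoids s t].
Proof.
apply/imageP/idP => [[a] | /and4P[/eqP sz Ha H1 H2]].
  by rewrite inE => H ->; rewrite size_map size_tuple eqxx.
have lts := ascent_seq_lt Ha; rewrite sz in lts.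
have Hv : map val (pmap (insub : nat -> option 'I_n) s) = s.
  rewrite pmap_filter; last exact: insubK.
  apply/all_filterP; apply/allP => x xs /=.
  by rewrite insubT //; exact: (allP lts).
have Hsz : size (pmap (insub : nat -> option 'I_n) s) == n.
  by rewrite -(size_map val) Hv sz.
by exists (Tuple Hsz); rewrite ?inE /= Hv ?Ha ?H1.
Qed.

Lemma uniq_B (n : nat) (t : seq nat) :
  uniq [seq map val (tval a) | a in B n t].
Proof.
rewrite map_inj_uniq ?enum_uniq // => u v /(inj_map val_inj) H.
exact: val_inj.
Qed.

Local Open Scope ring_scope.

(* A formal power series is its sequence of coefficients; equality of power
   series is equality of all coefficients ([=1]). *)
Definition fps (R : Type) := nat -> R.

Section FormalPowerSeries.
Variable R : comUnitRingType.
Implicit Types u v : fps R.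

Definition fps_of_poly (p : {poly R}) : fps R := fun n => p`_n.

Definition fps_mul u v : fps R :=
  fun n => \sum_(i < n.+1) u i * v (n - i)%N.

(* [fps_inv_seq u n] lists the coefficients of degree at most n of 1/u, given by
   (1/u)_0 = u_0^-1 and (1/u)_n = - u_0^-1 * \sum_(i < n) u_(n-i) * (1/u)_i;
   meaningful when u_0 is a unit. *)
Fixpoint fps_inv_seq u (n : nat) : seq R :=
  if n is n'.+1 then
    let s := fps_inv_seq u n' in
    rcons s (- (u 0)^-1 * \sum_(i < n) u (n - i)%N * s`_i)
  else [:: (u 0)^-1].

Definition fps_inv u : fps R := fun n => (fps_inv_seq u n)`_n.

Definition fps_div u v : fps R := fps_mul u (fps_inv v).

Lemma size_fps_inv_seq u n : size (fps_inv_seq u n) = n.+1.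
Proof. by elim: n => //= n IH; rewrite size_rcons IH. Qed.

Lemma nth_fps_inv_seq u n i :
  (i <= n)%N -> (fps_inv_seq u n)`_i = fps_inv u i.
Proof.
elim: n => [|n IH]; first by rewrite leqn0 => /eqP ->.
rewrite leq_eqVlt => /predU1P[-> // | Hi].
by rewrite /= nth_rcons size_fps_inv_seq Hi IH.
Qed.

Lemma fps_mulV u :
  u 0 \is a GRing.unit -> fps_mul u (fps_inv u) =1 fps_of_poly 1.
Proof.
move=> Hu [|n].
  by rewrite /fps_mul big_ord1 /fps_inv /fps_of_poly /= coef1 divrr.
rewrite /fps_mul /fps_of_poly coef1 /= big_ord_recl subn0 /=.
rewrite {1}/fps_inv /= nth_rcons size_fps_inv_seq ltnn eqxx.
rewrite mulrA mulrN divrr // mulN1r.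
apply/eqP; rewrite addrC subr_eq0; apply/eqP.
rewrite (reindex_inj rev_ord_inj) /=; apply: eq_bigr => i _.
have Hi : (i <= n)%N by rewrite -ltnS.
rewrite nth_fps_inv_seq // /bump /= add1n !subSS subKn //.
by rewrite -subSn.
Qed.

End FormalPowerSeries.

Definition f (t : seq nat) : fps int := fun n => (b n t)%:Z.

(* Main.v *)
Require Import Defs.
From mathcomp Require Import all_boot all_order all_algebra.
From mathcomp Require Import zify ring.

Import GRing.Theory.

(* An ascent sequence avoids 021 exactly when its nonzero letters weakly increase,
   so a letter appended to it is 0, the current maximum m, or one of the s + 1
   larger letters allowed by the slack s = asc - m. A new occurrence of tau can
   only be completed by a 0, and whether it is depends on a finite phase. This
   yields recurrences in the length and s for the numbers of completions; their
   generating functions in s are of the form (a + b s) r^s plus a term independent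
   of s, where r = (1 - x) / (1 - 2x). Eliminating s leaves the linear recurrence
   of order 5 given by the denominator (1 - 2x)(1 - 3x + x^2)^2. *)

(** * Linear recurrences *)

(** A fixpoint, so that [completions] computes and the initial values can be checked by
    conversion. *)
Fixpoint prefix_sum (g : nat -> nat) (s : nat) : nat :=
  if s is r.+1 then prefix_sum g r + g s else g 0.

Lemma prefix_sum0 g : prefix_sum g 0 = g 0.
Proof. by []. Qed.

Lemma prefix_sumS g s : prefix_sum g s.+1 = prefix_sum g s + g s.+1.
Proof. by []. Qed.

Lemma prefix_sumE g s : prefix_sum g s = \sum_(i < s.+1) g i.
Proof. by elim: s => [|s IH]; rewrite ?big_ord1 // big_ord_recr /= -IH. Qed.

Lemma eq_prefix_sum g h : g =1 h -> prefix_sum g =1 prefix_sum h.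
Proof. by move=> eq_gh s; rewrite !prefix_sumE; apply: eq_bigr. Qed.

(* In this section [W n s] and [V n s] count the completions by [n] letters of a
   word in phase [Rigid] with slack [s] whose last letter is nonzero, resp. zero;
   [E] and [F] do the same for phase [Free], [C] and [D] for phase [Unary].
   With r = (1 - x) / (1 - 2x), the generating functions of [W] and [V] are
   multiples of r ^ s; the [_shift] identities express this coefficientwise as
   (1 - 2x) g_(s+1) = (1 - x) g_s. *)
Section Recurrences.
Variables W V : nat -> nat -> nat.
Hypothesis W0 : forall s, W 0 s = 1.
Hypothesis V0 : forall s, V 0 s = 1.
Hypothesis WS : forall n s, W n.+1 s = W n s + prefix_sum (W n) s.
Hypothesis VS : forall n s, V n.+1 s = W n s.+1 + prefix_sum (W n) s.

(** Taking the difference in [s] reduces the prefix sum to its last term. *)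
Lemma W_shift n s : W n.+1 s.+1 + W n s = 2 * W n s.+1 + W n.+1 s.
Proof. by rewrite !WS prefix_sumS; lia. Qed.

Lemma V_shift n s : V n.+1 s.+1 + V n s = 2 * V n s.+1 + V n.+1 s.
Proof.
(* At positive length [V] is a linear combination of values of [W], so it inherits [W_shift]. *)
have VE k r : V k.+1 r + W k r = W k r.+1 + W k.+1 r by rewrite VS WS; lia.
case: n => [|n]; first by rewrite !VS !prefix_sumS !V0 !W0; lia.
move: (W_shift n s) (W_shift n s.+1) (W_shift n.+1 s).
by move: (VE n s) (VE n s.+1) (VE n.+1 s) (VE n.+1 s.+1); lia.
Qed.

(** * Linear recurrence for 1230 *)

Section Case1230.
Variables E F C D : nat -> nat -> nat.
Variable z : nat -> nat.
Hypothesis E0 : forall s, E 0 s = 1.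
Hypothesis F0 : forall s, F 0 s = 1.
Hypothesis ES : forall n s, E n.+1 s = F n s + E n s + prefix_sum (W n) s.
Hypothesis FS : forall n s, F n.+1 s = F n s + E n s.+1 + prefix_sum (W n) s.
Hypothesis C0 : forall s, C 0 s = 1.
Hypothesis D0 : forall s, D 0 s = 1.
Hypothesis CS : forall n s, C n.+1 s = D n s + C n s + prefix_sum (E n) s.
Hypothesis DS : forall n s, D n.+1 s = D n s + C n s.+1 + prefix_sum (E n) s.
Hypothesis z0 : z 0 = 1.
Hypothesis zS : forall n, z n.+1 = z n + C n 0.

(** The recurrences are linear, and their inhomogeneous term [prefix_sum (W n) s = W n.+1 s - W n s]
    satisfies the same identity by [W_shift]. *)
Lemma EF_shift_1230 n s :
  (E n.+1 s.+1 + E n s = 2 * E n s.+1 + E n.+1 s) /\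
  (F n.+1 s.+1 + F n s = 2 * F n s.+1 + F n.+1 s).
Proof.
elim: n s => [|n IH] s.
  by rewrite !ES !FS !E0 !F0 !prefix_sumS !W0; lia.
move: (IH s) (IH s.+1) (ES n s) (ES n s.+1) (FS n s) (FS n s.+1).
move: (ES n.+1 s) (ES n.+1 s.+1) (FS n.+1 s) (FS n.+1 s.+1).
move: (WS n s) (WS n s.+1) (WS n.+1 s) (WS n.+1 s.+1).
by move: (W_shift n s) (W_shift n.+1 s); lia.
Qed.

(** Sum of [EF_shift_1230] over the slacks from 0 to [s]; the values at slack 0 are boundary
    terms. *)
Lemma prefix_sum_E_shift_1230 n s :
  prefix_sum (E n.+1) s.+1 + prefix_sum (E n) s + 2 * E n 0 =
  2 * prefix_sum (E n) s.+1 + prefix_sum (E n.+1) s + E n.+1 0.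
Proof.
elim: s => [|s]; first by have := EF_shift_1230 n 0; rewrite !prefix_sumS !prefix_sum0; lia.
by have := EF_shift_1230 n s.+1; rewrite !prefix_sumS; lia.
Qed.

(** The boundary terms leave a defect independent of [s]. It is 0 for [n = 0], and each letter
    doubles it and adds [E n.+1 0 - 2 * E n 0]; since [W n 0] doubles as well, it equals
    [E n 0 - W n 0]. *)
Lemma CD_shift_1230 n s :
  (C n.+1 s.+1 + C n s + W n 0 = 2 * C n s.+1 + C n.+1 s + E n 0) /\
  (D n.+1 s.+1 + D n s + W n 0 = 2 * D n s.+1 + D n.+1 s + E n 0).
Proof.
elim: n s => [|n IH] s.
  by rewrite !CS !DS !C0 !D0 !prefix_sumS W0 !E0; lia.
move: (IH s) (IH s.+1) (CS n s) (CS n s.+1) (DS n s) (DS n s.+1).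
move: (CS n.+1 s) (CS n.+1 s.+1) (DS n.+1 s) (DS n.+1 s.+1).
move: (prefix_sum_E_shift_1230 n s) (WS n 0).
by rewrite !prefix_sum0; lia.
Qed.

Lemma E_rec_1230 n : E n.+2 0 + E n 0 = 3 * E n.+1 0.
Proof.
(* Eliminates the value at slack 1, which closes the system at slack 0. *)
have inv : E n 1 + W n 0 = E n 0 + F n 0.
  elim: n => [|n IH]; first by rewrite !E0 F0 W0.
  move: (ES n 0) (FS n 0) (EF_shift_1230 n 0) (WS n 0).
  by rewrite !prefix_sum0; lia.
move: (ES n 0) (FS n 0) (ES n.+1 0) (WS n 0).
by rewrite !prefix_sum0; lia.
Qed.

(** The relations [inv] eliminate [C k 1] and [D k 0]. The system left for [z] and [C] at slack 0
    has determinant (1 - x)(1 - 2x) - x^2 = 1 - 3x + x^2; its inputs [E] and [W] contribute the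
    factors 1 - 3x + x^2 and 1 - 2x. *)
Lemma linear_rec_1230 n :
  z n.+4.+1 + 23 * z n.+3 + 13 * z n.+1 = 8 * z n.+4 + 28 * z n.+2 + 2 * z n.
Proof.
have inv k : z k + C k 1 = 2 * D k 0 /\ z k + C k 0 = D k 0 + W k 0.
  elim: k => [|k IH]; first by rewrite z0 !C0 D0 W0.
  move: (zS k) (CS k 0) (DS k 0) (CD_shift_1230 k 0) (WS k 0).
  by rewrite !prefix_sum0; lia.
have step k :
    [/\ z k.+1 = z k + C k 0,
        C k.+1 0 + W k 0 = 2 * C k 0 + z k + E k 0
      & W k.+1 0 = 2 * W k 0].
  move: (inv k) (zS k) (CS k 0) (WS k 0).
  by rewrite !prefix_sum0; split; lia.
case: (step n) (step n.+1) (step n.+2) (step n.+3) (step n.+4).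
move=> ? ? ? [? ? ?] [? ? ?] [? ? ?] [? ? ?].
by move: (E_rec_1230 n) (E_rec_1230 n.+1); lia.
Qed.
End Case1230.

(** * Linear recurrence for 1200 and 1220 *)

Section Case1200.
Variables E C D : nat -> nat -> nat.
Variable z : nat -> nat.
Hypothesis E0 : forall s, E 0 s = 1.
Hypothesis ES : forall n s, E n.+1 s = V n s + E n s + prefix_sum (E n) s.
Hypothesis C0 : forall s, C 0 s = 1.
Hypothesis D0 : forall s, D 0 s = 1.
Hypothesis CS : forall n s, C n.+1 s = D n s + C n s + prefix_sum (E n) s.
Hypothesis DS : forall n s, D n.+1 s = D n s + C n s.+1 + prefix_sum (E n) s.
Hypothesis z0 : z 0 = 1.
Hypothesis zS : forall n, z n.+1 = z n + C n 0.

(* The coefficient of x^(n+1) in (1 - 2x) g_(s+1) - (1 - x) g_s; here the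
   generating functions are (a + b s) r ^ s, so only the second iterate vanishes. *)
Let defect (g : nat -> nat -> nat) (n s : nat) : int :=
  ((g n.+1 s.+1)%:Z + (g n s)%:Z - 2%:Z * (g n s.+1)%:Z - (g n.+1 s)%:Z)%R.

Lemma E_defect_1200 n s : defect E n s = ((V n s.+1)%:Z - (V n s)%:Z)%R.
Proof. by rewrite /defect; move: (ES n s) (ES n s.+1); rewrite prefix_sumS; lia. Qed.

Let defect2 (g : nat -> nat -> nat) (n s : nat) : int :=
  (defect g n.+1 s.+1 + defect g n s - 2%:Z * defect g n s.+1 - defect g n.+1 s)%R.

Lemma E_defect2_1200 n s : defect2 E n s = 0.
Proof.
by rewrite /defect2 !E_defect_1200; move: (V_shift n s) (V_shift n s.+1); lia.
Qed.

(** Since [prefix_sum (E n) s = E n.+1 s - V n s - E n s] and [V] has defect 0 by [V_shift], the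
    prefix sum contributes [defect E n.+1 s - defect E n s]. *)
Lemma CD_defect_1200 n s :
  (defect C n.+1 s = defect D n s + defect C n s + defect E n.+1 s - defect E n s)%R /\
  (defect D n.+1 s = defect D n s + defect C n s.+1 + defect E n.+1 s - defect E n s)%R.
Proof.
rewrite /defect.
move: (CS n s) (CS n s.+1) (DS n s) (DS n s.+1) (ES n s) (ES n s.+1).
move: (CS n.+1 s) (CS n.+1 s.+1) (DS n.+1 s) (DS n.+1 s.+1) (ES n.+1 s) (ES n.+1 s.+1).
by move: (V_shift n s); lia.
Qed.

Lemma CD_defect0_1200 s : defect C 0 s = 0 /\ defect D 0 s = 0.
Proof. by rewrite /defect !CS !DS !prefix_sumS !E0 !C0 !D0; lia. Qed.

(** By linearity [CD_defect_1200] carries over to second defects, where the terms from [E] vanish by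
    [E_defect2_1200]. *)
Lemma CD_defect2_1200 n s : defect2 C n s = 0 /\ defect2 D n s = 0.
Proof.
have C00 r : defect C 0 r = 0 by case: (CD_defect0_1200 r).
have D00 r : defect D 0 r = 0 by case: (CD_defect0_1200 r).
have E00 r : defect E 0 r = 0 by rewrite E_defect_1200 !V0.
elim: n s => [|n IH] s.
  move: (CD_defect_1200 0 s) (CD_defect_1200 0 s.+1) (E_defect2_1200 0 s).
  by rewrite /defect2 !C00 !D00 !E00; lia.
move: (CD_defect_1200 n s) (CD_defect_1200 n s.+1) (E_defect2_1200 n s).
move: (CD_defect_1200 n.+1 s) (CD_defect_1200 n.+1 s.+1) (E_defect2_1200 n.+1 s).
by move: (IH s) (IH s.+1); rewrite /defect2; lia.
Qed.

Lemma linear_rec_1200 n :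
  z n.+4.+1 + 23 * z n.+3 + 13 * z n.+1 = 8 * z n.+4 + 28 * z n.+2 + 2 * z n.
Proof.
have C00 r : defect C 0 r = 0 by case: (CD_defect0_1200 r).
have D00 r : defect D 0 r = 0 by case: (CD_defect0_1200 r).
(* The state consists of values at slacks 0 and 1. The vanishing second defect gives the next
   [defect C] at slack 1, which closes the system. *)
have step k :
  [/\ [/\ z k.+1 = z k + C k 0, C k.+1 0 = C k 0 + D k 0 + E k 0, D k.+1 0 = D k 0 + C k 1 + E k 0
     & ((C k.+1 1)%:Z + (C k 0)%:Z = 2%:Z * (C k 1)%:Z + (C k.+1 0)%:Z + defect C k 0)%R],
   [/\ E k.+1 0 = 2 * E k 0 + V k 0, W k.+1 0 = 2 * W k 0, W k.+1 1 = 2 * W k 1 + W k 0,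
     V k.+1 0 = W k 0 + W k 1 & V k.+1 1 + V k 0 = 2 * V k 1 + V k.+1 0] &
   [/\ (defect C k.+1 0 = defect D k 0 + defect C k 0
          + (V k.+1 1)%:Z - (V k.+1 0)%:Z - (V k 1)%:Z + (V k 0)%:Z)%R,
       (defect D k.+1 0 = defect D k 0 + defect C k 1
          + (V k.+1 1)%:Z - (V k.+1 0)%:Z - (V k 1)%:Z + (V k 0)%:Z)%R
     & (defect C k.+1 1 + defect C k 0 = 2%:Z * defect C k 1 + defect C k.+1 0)%R]].
  have defectE : defect C k 0 =
      ((C k.+1 1)%:Z + (C k 0)%:Z - 2%:Z * (C k 1)%:Z - (C k.+1 0)%:Z)%R by [].
  move: (CD_defect2_1200 k 0) (CD_defect_1200 k 0) (V_shift k 0).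
  move: (zS k) (CS k 0) (DS k 0) (ES k 0) (VS k 0) (WS k 0) (WS k 1).
  rewrite /defect2 !E_defect_1200 !prefix_sumS !prefix_sum0.
  by do 2!split; lia.
(* The linear relations that hold for the initial values at k = 0 and that the
   transition [step] preserves. *)
have inv k :
  [/\ ((C k 1)%:Z + defect C k 1 + (E k 0)%:Z = (C k 0)%:Z + (D k 0)%:Z + 2%:Z * defect D k 0)%R,
   (defect C k 1 + (V k 1)%:Z = defect C k 0 + defect D k 0 + (V k 0)%:Z)%R,
   ((C k 1)%:Z + defect C k 0 + (W k 0)%:Z = (C k 0)%:Z + (D k 0)%:Z + defect D k 0)%R &
   ((z k)%:Z + (C k 1)%:Z + defect C k 0 + 2%:Z * defect C k 1 + (W k 1)%:Z
      = 2%:Z * (D k 0)%:Z + 4%:Z * defect D k 0 + (V k 0)%:Z)%R].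
  elim: k => [|k [i1 i2 i3 i4]]; first by rewrite z0 !C0 !D0 !E0 !W0 !V0 !C00 !D00.
  move: (step k) => [[? ? ? ?] [? ? ? ? ?] [? ? ?]].
  by split; lia.
(* The transitions write both sides as linear forms in the state at [n]; the invariants make these
   forms equal. *)
move: (inv n) => [? ? ? ?].
case: (step n) (step n.+1) (step n.+2) (step n.+3) (step n.+4).
move=> [? ? ? ?] [? ? ? ? ?] [? ? ?].
do 4!case=> [[? ? ? ?] [? ? ? ? ?] [? ? ?]].
by lia.
Qed.
End Case1200.
End Recurrences.

(** * Pattern containment *)

(** On natural numbers [<] in both directions determines equality, so the equality clause of
    [contains] is implied. *)
Definition order_iso (s t : seq nat) : bool :=
  (size s == size t) &&
  all (fun j => all (fun k =>
    (nth 0 s j < nth 0 s k) == (nth 0 t j < nth 0 t k))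
  (iota 0 (size t))) (iota 0 (size t)).

Lemma order_isoP s t :
  reflect (size s = size t /\ forall j k, j < size t -> k < size t ->
             (nth 0 s j < nth 0 s k) = (nth 0 t j < nth 0 t k))
          (order_iso s t).
Proof.
apply: (iffP andP) => [[/eqP-> /allP H]|[-> H]].
  split=> // j k Hj Hk; have := H j; rewrite mem_iota => /(_ Hj)/allP/(_ k).
  by rewrite mem_iota => /(_ Hk)/eqP.
split=> //; apply/allP => j; rewrite mem_iota => Hj.
by apply/allP => k; rewrite mem_iota => Hk; apply/eqP/H.
Qed.

(** An embedding of indices is the same as its increasing list [l] of positions, a subsequence of
    [iota 0 (size p)]; conversely, a mask of [p] selects such a list. *)
Lemma containsP p t :
  reflect (exists2 s, subseq s p & order_iso s t) (contains p t).
Proof.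
apply: (iffP existsP) => [[f /forallP fP]|[s /subseqP[m sz_m ->] /order_isoP[sz_s sP]]].
  have fP' j k := and3P (forallP (fP j) k).
  pose l := [seq val (f j) | j <- enum 'I_(size t)].
  have sz_l : size l = size t by rewrite size_map size_enum_ord.
  have lE (j : 'I_(size t)) : nth 0 l j = f j.
    by rewrite (nth_map j) ?size_enum_ord // nth_ord_enum.
  have l_sorted : sorted ltn l.
    apply/(sortedP 0) => i; rewrite sz_l => Hi.
    rewrite (lE (Ordinal Hi)) (lE (Ordinal (ltnW Hi))).
    have [/implyP lt_f _ _] := fP' (Ordinal (ltnW Hi)) (Ordinal Hi).
    by apply: lt_f => /=.
  have l_sub : subseq l (iota 0 (size p)).
    apply/subseq_uniqP; first exact: iota_uniq.
    apply: (irr_sorted_eq ltn_trans ltnn) => //.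
      exact/(sorted_filter ltn_trans)/iota_ltn_sorted.
    move=> x; rewrite mem_filter mem_iota /= andbC.
    by case: mapP => [[j _ ->]|]; rewrite ?andbF ?ltn_ord.
  exists [seq nth 0 p i | i <- l].
    by rewrite -[X in subseq _ X](mkseq_nth 0); exact: map_subseq.
  apply/order_isoP; split=> [|j k Hj Hk]; first by rewrite size_map.
  rewrite !(nth_map 0) ?sz_l // (lE (Ordinal Hj)) (lE (Ordinal Hk)).
  by have [_ /eqP] := fP' (Ordinal Hj) (Ordinal Hk).
pose l := mask m (iota 0 (size p)).
have sE : mask m p = [seq nth 0 p i | i <- l].
  by rewrite map_mask -/(mkseq _ _) mkseq_nth.
have sz_l : size l = size t by rewrite -sz_s sE size_map.
have l_sorted : sorted ltn l by apply/(sorted_mask ltn_trans)/iota_ltn_sorted.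
have ltl (j : 'I_(size t)) : nth 0 l j < size p.
  have: nth 0 l j \in l by rewrite mem_nth ?sz_l.
  by move/mem_mask; rewrite mem_iota.
exists [ffun j => Ordinal (ltl j)].
apply/forallP => j; apply/forallP => k; rewrite !ffunE /=.
have lt_nth (i i' : 'I_(size t)) : (nth 0 p (nth 0 l i) < nth 0 p (nth 0 l i')) =
    (nth 0 t i < nth 0 t i').
  by rewrite -sP // sE !(nth_map 0) ?sz_l.
apply/and3P; split; last by rewrite !eqn_leq !(leqNgt (nth 0 _ _)) !lt_nth.
  apply/implyP => ltjk.
  by apply: (sorted_ltn_nth ltn_trans) => //; rewrite inE sz_l.
by rewrite lt_nth.
Qed.

Lemma subseq_rcons_rcons (T : eqType) (s w : seq T) x a :
  subseq (rcons s x) (rcons w a) =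
  subseq (rcons s x) w || (x == a) && subseq s w.
Proof.
elim: w s => [|b w IH] [|y s] //=; rewrite ?orbF ?andbT //.
- by case: (x == a).
- by rewrite andbF; case: (y == a) => //; case: s.
- by case: (x == b); rewrite ?sub0seq // (IH [::]) sub0seq andbT.
by case: (y == b); rewrite ?IH // -!rcons_cons IH.
Qed.

Lemma contains_rcons w a t : 0 < size t ->
  reflect (contains w t \/ exists2 s, subseq s w & order_iso (rcons s a) t)
          (contains (rcons w a) t).
Proof.
move=> t0; apply: (iffP (containsP _ _)) => [[s + iso]|[/containsP[s sub iso]|[s sub iso]]].
- case/lastP: s iso => [|s x] iso; first by case/order_isoP: iso t0 => <-.
  rewrite subseq_rcons_rcons => /orP[sub|/andP[/eqP xa sub]].
    by left; apply/containsP; exists (rcons s x).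
  by right; exists s => //; rewrite -xa.
- by exists s => //; apply: subseq_trans sub (subseq_rcons _ _).
by exists (rcons s a) => //; rewrite subseq_rcons_rcons eqxx sub orbT.
Qed.

Lemma contains_catl u v t : contains u t -> contains (u ++ v) t.
Proof.
case/containsP=> s sub iso; apply/containsP; exists s => //.
exact: subseq_trans sub (prefix_subseq _ _).
Qed.

(** * Ascent sequences *)

Lemma ascent_seqP (a : seq nat) :
  reflect (nth 0 a 0 = 0 /\
           forall i, 0 < i < size a -> nth 0 a i <= (asc (take i a)).+1)
          (ascent_seq a).
Proof.
apply: (iffP forallP) => [H|[H0 H] i].
  split=> [|i /andP[i0 Hi]].
    case: a H => // x a H; by have /eqP := H (Ordinal (ltn0Sn _)).
  have := H (Ordinal Hi); rewrite /= gtn_eqF // addn1; exact.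
case: (posnP (val i)) => [->|i0]; first exact/eqP.
by rewrite addn1; apply: H; rewrite i0 /=.
Qed.

Lemma ascent_seq_rcons w a :
  ascent_seq (rcons w a) =
  ascent_seq w && (if w is [::] then a == 0 else a <= (asc w).+1).
Proof.
apply/ascent_seqP/andP => [[H0 H]|[/ascent_seqP[H0 H] Ha]].
  split; last first.
    case: w H0 H => [/eqP //|x w] H0 H.
    have := H (size w).+1; rewrite !size_rcons /= nth_rcons ltnn eqxx -cats1.
    by rewrite take_size_cat // => ->.
  apply/ascent_seqP; split=> [|i /andP[i0 Hi]].
    by case: w H0 {H}.
  have := H i; rewrite size_rcons nth_rcons Hi i0 ltnS (ltnW Hi) -cats1 => /(_ isT).
  by rewrite takel_cat // ltnW.
split=> [|i]; first by case: w H0 H Ha => // _ _ /eqP.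
rewrite size_rcons ltnS => /andP[i0 Hi].
rewrite nth_rcons -cats1 takel_cat //; case: ltngtP Hi => // [Hi|Hi] _.
  by apply: H; rewrite i0.
by rewrite Hi take_size; case: w i Hi i0 Ha {H0 H} => [|x w] i -> .
Qed.

(** The default [a] of [last] yields no ascent when [w] is empty. *)
Lemma asc_rcons w a : asc (rcons w a) = asc w + (last a w < a).
Proof.
case/lastP: w => [|w x]; first by rewrite /asc /= ltnn.
rewrite /asc !size_rcons !succnK -[(size w).+1]addn1 iotaD count_cat add0n /= last_rcons addn0.
congr (_ + nat_of_bool _).
  apply: eq_in_count => i; rewrite mem_iota /= add0n => Hi.
  by rewrite !(nth_rcons _ (rcons w x)) !size_rcons !ltnS Hi (ltnW Hi).
by rewrite !nth_rcons !size_rcons ltnSn ltnn !eqxx ltnn.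
Qed.

(** * Appending a letter *)

Definition valid (t w : seq nat) : bool :=
  [&& ascent_seq w, avoids w [:: 0; 2; 1] & avoids w t].

(** The range ends at the ascent bound [asc w + 1]. For empty [w] it still contains 1, which [valid]
    rejects. *)
Fixpoint suffixes (t w : seq nat) (n : nat) : seq (seq nat) :=
  if n is k.+1 then
    [seq a :: v | a <- [seq a <- iota 0 (asc w).+2 | valid t (rcons w a)],
                  v <- suffixes t (rcons w a) k]
  else [:: [::]].

Lemma suffixesS t w n :
  suffixes t w n.+1 =
  [seq a :: v | a <- [seq a <- iota 0 (asc w).+2 | valid t (rcons w a)],
                v <- suffixes t (rcons w a) n].
Proof. by []. Qed.

(** This is why testing every prefix in [suffixes] loses no valid word. *)
Lemma valid_catl t u v : valid t (u ++ v) -> valid t u.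
Proof.
elim/last_ind: v => [|v a IH]; first by rewrite cats0.
rewrite -rcons_cat => /and3P[]; rewrite ascent_seq_rcons => /andP[Ha _] H1 H2.
apply: IH; apply/and3P; split=> //.
  by apply: contra H1 => H; rewrite -cats1 contains_catl.
by apply: contra H2 => H; rewrite -cats1 contains_catl.
Qed.

Lemma mem_suffixes t w n v : valid t w ->
  (v \in suffixes t w n) = (size v == n) && valid t (w ++ v).
Proof.
elim: n w v => [|n IH] w v valid_w.
  by rewrite inE; case: v => //=; rewrite cats0 valid_w.
rewrite suffixesS; apply/allpairsPdep/andP => [[a [u []]]|].
  rewrite mem_filter => /andP[valid_wa _]; rewrite IH // => /andP[/eqP <- H] -> /=.
  by rewrite eqxx -cat_rcons.
case: v => [|a v] [] //; rewrite [size _]/= eqSS -cat_rcons => sz_v H; exists a, v.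
have valid_wa := valid_catl _ _ _ H; split=> //; last by rewrite IH // sz_v.
rewrite mem_filter valid_wa mem_iota /= add0n ltnS.
by case/and3P: valid_wa; rewrite ascent_seq_rcons => /andP[_]; case: (w) => [/eqP->|].
Qed.

Lemma uniq_suffixes t w n : uniq (suffixes t w n).
Proof.
elim: n w => [|n IH] w //; rewrite suffixesS; apply: allpairs_uniq_dep => //.
  exact/filter_uniq/iota_uniq.
by move=> [a u] [c v] _ _ /= [-> ->].
Qed.

Lemma valid_nil t : 0 < size t -> valid t [::].
Proof.
have nil_avoids p : 0 < size p -> avoids [::] p.
  move=> p0; apply/containsP => -[s]; rewrite subseq0 => /eqP-> /order_isoP[sz _].
  by rewrite -sz in p0.
move=> t0; apply/and3P; split; try exact: nil_avoids.
by apply/ascent_seqP; split=> // i; rewrite ltn0 andbF.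
Qed.

Lemma b_suffixes t n : 0 < size t -> b n t = size (suffixes t [::] n).
Proof.
move=> t0; rewrite /b -(size_image (fun a : n.-tuple 'I_n => map val (tval a))).
apply/perm_size/uniq_perm; [exact: uniq_B|exact: uniq_suffixes|move=> v].
by rewrite mem_B mem_suffixes ?valid_nil.
Qed.

Lemma size_suffixesS t w n :
  size (suffixes t w n.+1) =
  \sum_(0 <= a < (asc w).+2 | valid t (rcons w a)) size (suffixes t (rcons w a) n).
Proof. by rewrite suffixesS size_allpairs_dep sumnE big_map big_filter. Qed.

Section AppendLetter.
Variable t : seq nat.
Hypothesis last_lt_head : nth 0 t (size t).-1 < nth 0 t 0.

Let t0 : 0 < size t.
Proof. by case: (t) last_lt_head. Qed.

Definition zero_forbidden (w : seq nat) : Prop :=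
  exists2 s, subseq s w & order_iso (rcons s 0) t.

Lemma zero_forbidden_rcons w a : zero_forbidden w -> zero_forbidden (rcons w a).
Proof. by case=> s sub iso; exists s => //; apply: subseq_trans sub (subseq_rcons _ _). Qed.

(** A nonzero letter below an earlier one would complete 021 with the initial 0. By [last_lt_head],
    a letter completing [t] lies below an earlier one, so among the remaining letters only 0 can
    complete [t]. *)
Lemma valid_rcons w a : valid t w -> 0 < size w ->
  valid t (rcons w a) <->
  a <= (asc w).+1 /\
  if a == 0 then ~ zero_forbidden w else {in w, forall x, x <= a}.
Proof.
move=> /and3P[asc_w av021 avt] w0; rewrite /valid ascent_seq_rcons asc_w /=.
have -> : (if w is [::] then a == 0 else a <= (asc w).+1) = (a <= (asc w).+1).
  by case: (w) w0.
have w_head : 0 :: behead w = w.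
  by case: (w) w0 asc_w => //= x v _ /ascent_seqP[/= -> _].
split=> [/and3P[le_a av1 av2]|[le_a H]].
  split=> //; case: eqP => [a0|/eqP a0].
    by move=> F; case/negP: av2; apply/contains_rcons => //; right; rewrite a0.
  move=> x xw; rewrite leqNgt; apply/negP => ltax; case/negP: av1.
  apply/contains_rcons => //; right; exists [:: 0; x]; last by rewrite /order_iso /=; lia.
  rewrite -w_head /= sub1seq.
  by move: xw; rewrite -{1}w_head inE => /orP[/eqP x0|//]; rewrite x0 in ltax.
rewrite le_a /=; apply/andP; split; apply/contains_rcons => //.
  case=> [|[s sub iso]]; first exact/negP.
  case/order_isoP: iso; rewrite size_rcons; case: s sub => [|x [|y [|? ?]]] // sub _ iso.
  move: (iso 0 2 isT isT) (iso 2 1 isT isT) => /= .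
  have yw : y \in w by apply: (mem_subseq sub); rewrite !inE eqxx orbT.
  by case: eqP H => [->|_ /(_ y yw)]; lia.
case=> [|[s sub iso]]; first exact: (negP avt).
case: eqP H => [a0|_ le_w]; first by case; exists s => //; rewrite -a0.
case/order_isoP: iso; rewrite size_rcons => sz_s.
have pos_t : (size t).-1 < size t by rewrite prednK.
move=> /(_ _ 0 pos_t t0); rewrite last_lt_head -sz_s /= nth_rcons ltnn eqxx.
have s0 : 0 < size s.
  by case: (s) sz_s last_lt_head => // <-; rewrite ltnn.
rewrite nth_rcons s0 => lt_a.
by have := le_w _ (mem_subseq sub (mem_nth 0 s0)); rewrite leqNgt lt_a.
Qed.

(** The sum over larger letters is reversed so that its index [i] is the new slack: the letter
    [m + (s - i).+1] raises the number of ascents to [(m + s).+1]. *)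
Lemma size_suffixes_step w m s n :
  valid t w -> 0 < m -> m \in w -> {in w, forall x, x <= m} -> asc w = m + s ->
  (if valid t (rcons w 0) then size (suffixes t (rcons w 0) n) else 0)
  + size (suffixes t (rcons w m) n)
  + \sum_(i < s.+1) size (suffixes t (rcons w (m + (s - i).+1)) n)
  = size (suffixes t w n.+1).
Proof.
move=> valid_w m0 mw le_m asc_w; rewrite size_suffixesS asc_w.
have w0 : 0 < size w by case: (w) mw.
have validE a : 0 < a -> a <= (m + s).+1 -> valid t (rcons w a) = (m <= a).
  move=> a0 le_a; have [valid_only_if valid_if] := valid_rcons _ a valid_w w0.
  apply/idP/idP => [/valid_only_if[_]|le_ma]; first by rewrite gtn_eqF // => /(_ m mw).
  by apply: valid_if; rewrite asc_w gtn_eqF //; split=> // x /le_m /leq_trans ->.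
set F := fun a => size (suffixes t (rcons w a) n).
rewrite [in RHS]big_mkcond big_ltn // -addnA; congr (_ + _).
rewrite (@big_cat_nat _ _ _ m) //=; last by lia.
rewrite [X in _ = X + _]big_nat_cond [X in _ = X + _]big1 ?add0n => [|a]; last first.
  by move=> /andP[/andP[a0 lt_am] _]; rewrite validE ?ifF //; lia.
have shift G : \sum_(m <= a < (m + s).+2) G a = \sum_(j < s.+2) G (j + m).
  by rewrite -{1}[m]add0n big_addn (_ : (m + s).+2 - m = s.+2) ?big_mkord //; lia.
rewrite shift big_ord_recl add0n validE ?leqnn //; last by lia.
congr (_ + _); rewrite (reindex_inj rev_ord_inj) /=; apply: eq_bigr => i _.
have lt_is := ltn_ord i; rewrite subSS /bump /= validE; [|lia|lia].
rewrite ifT; last by lia.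
by congr (size (suffixes t (rcons w _) n)); lia.
Qed.
End AppendLetter.

(** * Phases *)

(* [Unary]: only one nonzero value has occurred; [Free]: several have, and a zero
   may still be appended; [Rigid]: a zero would complete the pattern. *)
Inductive phase := Unary | Free | Rigid.

Section Completions.
(** The phases reached from [Free] by appending 0, the current maximum, or a larger letter. *)
Variables free_zero free_same free_up : phase.

(* [z] tells whether the last letter is zero; the slack [s] is the number of
   ascents minus the largest letter. *)
Fixpoint completions (n : nat) (p : phase) (z : bool) (s : nat) : nat :=
  if n is k.+1 then
    match p with
    | Unary => completions k Unary true s + completions k Unary false (s + z)
               + prefix_sum (completions k Free false) s
    | Free => completions k free_zero true s + completions k free_same false (s + z)
              + prefix_sum (completions k free_up false) s
    | Rigid => completions k Rigid false (s + z)
               + prefix_sum (completions k Rigid false) s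
    end
  else 1.

(** Counts the completions of an all-zero word: its first nonzero letter can only be 1, and the
    slack is then 0. *)
Fixpoint zero_completions (n : nat) : nat :=
  if n is k.+1 then zero_completions k + completions k Unary false 0 else 1.

Variables (t : seq nat) (free : nat -> seq nat -> Prop).

Definition in_phase (p : phase) (m : nat) (w : seq nat) : Prop :=
  match p with
  | Unary => {in w, forall x, (x == 0) || (x == m)}
  | Free => free m w
  | Rigid => zero_forbidden t w
  end.

Hypothesis last_lt_head : nth 0 t (size t).-1 < nth 0 t 0.
Hypothesis unary_zero : forall m w, in_phase Unary m w -> ~ zero_forbidden t w.
Hypothesis unary_up : forall m a w, in_phase Unary m w -> 0 < m -> m \in w ->
  m < a -> free a (rcons w a).
Hypothesis free_allowed : forall m w, free m w -> ~ zero_forbidden t w.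
Hypothesis free_append_zero : forall m w, free m w -> {in w, forall x, x <= m} ->
  in_phase free_zero m (rcons w 0).
Hypothesis free_append_same : forall m w, free m w -> {in w, forall x, x <= m} ->
  in_phase free_same m (rcons w m).
Hypothesis free_append_up : forall m a w, free m w -> {in w, forall x, x <= m} ->
  m < a -> in_phase free_up a (rcons w a).

(** Induction on [n]: the phase, the slack and whether the last letter is zero determine the same
    data after each admissible letter, so the maximum [m] drops out of the count. *)
Lemma size_suffixes n p m w s :
  valid t w -> 0 < m -> m \in w -> {in w, forall x, x <= m} ->
  (last 0 w == 0) || (last 0 w == m) -> in_phase p m w -> asc w = m + s ->
  size (suffixes t w n) = completions n p (last 0 w == 0) s.
Proof.
elim: n p m w s => [|n IH] p m w s // valid_w m0 mw le_m last_w w_p asc_w.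
have w0 : 0 < size w by case: (w) mw.
have valid_if a := (valid_rcons t last_lt_head w a valid_w w0).2.
have asc_cons a : asc (rcons w a) = asc w + (last 0 w < a).
  by rewrite asc_rcons; case: (w) w0.
have ext_up a q : m < a -> a <= (m + s).+1 -> in_phase q a (rcons w a) ->
    size (suffixes t (rcons w a) n) = completions n q false ((m + s).+1 - a).
  move=> lt_ma le_a a_q; rewrite (IH q a _ ((m + s).+1 - a)) //.
  - by rewrite last_rcons; case: (a) lt_ma.
  - apply: valid_if; rewrite asc_w; split=> //; rewrite gtn_eqF; last by lia.
    by move=> x /le_m; lia.
  - lia.
  - by rewrite mem_rcons inE eqxx.
  - by move=> x; rewrite mem_rcons inE => /orP[/eqP->|/le_m]; lia.
  - by rewrite last_rcons eqxx orbT.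
  by rewrite asc_cons asc_w; lia.
(* After a zero, repeating [m] is an ascent that leaves the maximum unchanged, so the slack grows by
   one. *)
have ext_same q : in_phase q m (rcons w m) ->
    size (suffixes t (rcons w m) n) = completions n q false (s + (last 0 w == 0)).
  move=> m_q; rewrite (IH q m _ (s + (last 0 w == 0))) //.
  - by rewrite last_rcons gtn_eqF.
  - by apply: valid_if; rewrite asc_w gtn_eqF //; split=> //; lia.
  - by rewrite mem_rcons inE eqxx.
  - by move=> x; rewrite mem_rcons inE => /orP[/eqP->|/le_m].
  - by rewrite last_rcons eqxx orbT.
  by rewrite asc_cons asc_w; lia.
have ext_zero q : ~ zero_forbidden t w -> in_phase q m (rcons w 0) ->
    (if valid t (rcons w 0) then size (suffixes t (rcons w 0) n) else 0) =
    completions n q true s.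
  move=> allowed zero_q; have valid_w0 : valid t (rcons w 0) by apply: valid_if.
  rewrite valid_w0 (IH q m _ s) //.
  - by rewrite last_rcons.
  - by rewrite mem_rcons inE mw orbT.
  - by move=> x; rewrite mem_rcons inE => /orP[/eqP->|/le_m].
  - by rewrite last_rcons.
  by rewrite asc_cons asc_w ltn0 addn0.
have no_zero : zero_forbidden t w -> valid t (rcons w 0) = false.
  by move=> F; apply/negP => /(valid_rcons t last_lt_head w 0 valid_w w0)[_]; apply.
rewrite -(size_suffixes_step t last_lt_head w m s n) //.
have ext_ups q : (forall a, m < a -> in_phase q a (rcons w a)) ->
    \sum_(i < s.+1) size (suffixes t (rcons w (m + (s - i).+1)) n) =
    prefix_sum (completions n q false) s.
  move=> w_q; rewrite prefix_sumE; apply: eq_bigr => i _; have lt_is := ltn_ord i.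
  rewrite (ext_up _ q); [congr completions| | |apply: w_q]; lia.
case: p w_p => w_p /=.
- rewrite (ext_zero Unary) ?(ext_same Unary) ?(ext_ups Free) //.
  + by move=> a; apply: unary_up.
  + by move=> x; rewrite mem_rcons inE => /orP[/eqP->|/w_p //]; rewrite eqxx orbT.
  + exact: unary_zero w_p.
  by move=> x; rewrite mem_rcons inE => /orP[/eqP->|/w_p //].
- rewrite (ext_zero free_zero) ?(ext_same free_same) ?(ext_ups free_up) //.
  + by move=> a; apply: free_append_up.
  + exact: free_append_same.
  + exact: free_allowed w_p.
  exact: free_append_zero.
rewrite no_zero // add0n (ext_same Rigid) ?(ext_ups Rigid) //.
  by move=> a _; apply: zero_forbidden_rcons.
exact: zero_forbidden_rcons.
Qed.

Lemma size_suffixes_zeros n k :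
  valid t (nseq k.+1 0) -> size (suffixes t (nseq k.+1 0) n) = zero_completions n.
Proof.
elim: n k => [|n IH] k // valid_w; rewrite size_suffixesS.
have asc_w j : asc (nseq j 0) = 0.
  by elim: j => // j IHj; rewrite -addn1 nseqD cats1 asc_rcons IHj ltn0.
have allowed : ~ zero_forbidden t (nseq k.+1 0).
  by apply: (unary_zero 0) => x; rewrite mem_nseq => /andP[_ ->].
have rcons0 : rcons (nseq k.+1 0) 0 = nseq k.+2 0.
  by rewrite -cats1 -(nseqD k.+1 1) addn1.
have valid0 : valid t (rcons (nseq k.+1 0) 0).
  by apply/valid_rcons => //; split.
have valid1 : valid t (rcons (nseq k.+1 0) 1).
  apply/valid_rcons; rewrite ?asc_w //; split=> // x.
  by rewrite mem_nseq => /andP[_ /eqP->].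
rewrite asc_w big_ltn_cond // valid0 big_ltn_cond // valid1 big_geq // addn0 rcons0 IH -?rcons0 //.
congr (_ + _); rewrite (size_suffixes n Unary 1 _ 0) ?last_rcons //.
- by rewrite mem_rcons inE eqxx.
- by move=> x; rewrite mem_rcons inE mem_nseq => /orP[/eqP->|/eqP->].
- by move=> x; rewrite mem_rcons inE mem_nseq => /orP[/eqP->|/eqP->].
by rewrite asc_rcons asc_w; case: (k) => //= j; elim: j.
Qed.

(** The first letter must be 0, which accounts for the index shift. *)
Lemma b_completions n : b n.+1 t = zero_completions n.
Proof.
have t0 : 0 < size t by case: (t) last_lt_head.
have t1 : 1 < size t by case: (t) last_lt_head => [|x [|y v]] //; rewrite ltnn.
have avoids0 p : 1 < size p -> avoids [:: 0] p.
  move=> p1; apply/containsP => -[s /size_subseq sub /order_isoP[sz _]].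
  by move: sub; rewrite sz leqNgt p1.
have valid0 : valid t (nseq 1 0).
  by apply/and3P; split; rewrite ?avoids0 //; apply/ascent_seqP; split=> // -[|i].
have invalid1 : valid t (rcons [::] 1) = false.
  by apply/and3P => -[/ascent_seqP[]].
rewrite b_suffixes // size_suffixesS.
rewrite big_ltn_cond // [valid _ _]valid0 big_ltn_cond // invalid1 big_geq // addn0.
exact: (size_suffixes_zeros n 0).
Qed.

End Completions.

(** * The three patterns *)

Lemma zero_forbidden_1230P w :
  zero_forbidden [:: 1; 2; 3; 0] w <->
  exists x y u, [/\ subseq [:: x; y; u] w, 0 < x, x < y & y < u].
Proof.
split=> [[s sub /andP[/eqP]]|[x [y [u [sub x0 xy yu]]]]].
  rewrite size_rcons; case: s sub => [|x [|y [|u [|? ?]]]] // sub _ /= iso.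
  by exists x, y, u; split=> //; lia.
by exists [:: x; y; u] => //; rewrite /order_iso /=; lia.
Qed.

Lemma zero_forbidden_1220P w :
  zero_forbidden [:: 1; 2; 2; 0] w <->
  exists x y, [/\ subseq [:: x; y; y] w, 0 < x & x < y].
Proof.
split=> [[s sub /andP[/eqP]]|[x [y [sub x0 xy]]]].
  rewrite size_rcons; case: s sub => [|x [|y [|u [|? ?]]]] // sub _ /= iso.
  have uy : u = y by lia.
  by exists x, y; rewrite uy in sub; split=> //; lia.
by exists [:: x; y; y] => //; rewrite /order_iso /=; lia.
Qed.

Lemma zero_forbidden_1200P w :
  zero_forbidden [:: 1; 2; 0; 0] w <->
  exists x y, [/\ subseq [:: x; y; 0] w, 0 < x & x < y].
Proof.
split=> [[s sub /andP[/eqP]]|[x [y [sub x0 xy]]]].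
  rewrite size_rcons; case: s sub => [|x [|y [|u [|? ?]]]] // sub _ /= iso.
  have u0 : u = 0 by lia.
  by exists x, y; rewrite u0 in sub; split=> //; lia.
by exists [:: x; y; 0] => //; rewrite /order_iso /=; lia.
Qed.

(** Exactly two nonzero values have occurred, so any larger letter creates the first 123 among
    nonzero letters. *)
Definition free_1230 (m : nat) (w : seq nat) : Prop :=
  exists x, [/\ 0 < x, x < m, subseq [:: x; m] w &
                {in w, forall y, [|| y == 0, y == x | y == m]}].

(** With the pair [x], [m] present, another [m] creates 122, and a 0 creates 120. *)
Definition free_pair (t : seq nat) (m : nat) (w : seq nat) : Prop :=
  (exists x, [/\ 0 < x, x < m & subseq [:: x; m] w]) /\ ~ zero_forbidden t w.

Lemma subseq_rconsl (s w : seq nat) a : subseq s w -> subseq s (rcons w a).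
Proof. by move/subseq_trans; apply; apply: subseq_rcons. Qed.

Lemma subseq_pair_rcons (w : seq nat) m a : m \in w -> subseq [:: m; a] (rcons w a).
Proof. by move=> mw; rewrite (subseq_rcons_rcons _ [:: m]) eqxx sub1seq mw orbT. Qed.

(** Only a third nonzero value makes a later zero forbidden, so [Rigid] is reached by a larger
    letter. *)
Lemma b_1230 n : b n.+1 [:: 1; 2; 3; 0] = zero_completions Free Free Rigid n.
Proof.
have tripleP m w (H : {in w, forall x, (x == 0) || (x == m)}) x y :
    subseq [:: x; y] w -> 0 < x -> x < y -> False.
  move=> sub x0 xy.
  have := H x (mem_subseq sub (mem_head _ _)).
  by have := H y (mem_subseq sub (mem_last _ [:: y])); lia.
apply: (b_completions _ _ _ _ free_1230) => //.
- move=> m w H /zero_forbidden_1230P[x [y [u [sub x0 xy yu]]]].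
  apply: (tripleP m w H x y) => //; apply: subseq_trans sub.
  by rewrite -[[:: x; y; u]]/([:: x; y] ++ [:: u]) prefix_subseq.
- move=> m a w H m0 mw ma; exists m; split=> //; first exact: subseq_pair_rcons.
  by move=> y; rewrite mem_rcons inE => /orP[->|/H]; rewrite ?orbT //; lia.
- move=> m w [x [x0 xm _ H]] /zero_forbidden_1230P[y1 [y2 [y3 [sub p1 p2 p3]]]].
  move: (H y1) (H y2) (H y3); rewrite !(mem_subseq sub) ?inE ?eqxx ?orbT //.
  by move=> /(_ isT) + /(_ isT) + /(_ isT); lia.
- move=> m w [x [x0 xm sub H]] _; exists x; split=> //; first exact: subseq_rconsl.
  by move=> y; rewrite mem_rcons inE => /orP[->|/H].
- move=> m w [x [x0 xm sub H]] _; exists x; split=> //; first exact: subseq_rconsl.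
  by move=> y; rewrite mem_rcons inE => /orP[->|/H]; rewrite ?orbT.
move=> m a w [x [x0 xm sub H]] _ ma; apply/zero_forbidden_1230P; exists x, m, a.
by split=> //; rewrite (subseq_rcons_rcons _ [:: x; m]) eqxx sub orbT.
Qed.

(** Repeating the maximum produces 122 and leads to [Rigid]; a larger letter starts a new pair. *)
Lemma b_1220 n : b n.+1 [:: 1; 2; 2; 0] = zero_completions Free Rigid Free n.
Proof.
have unary_zero m w : {in w, forall x, (x == 0) || (x == m)} ->
    ~ zero_forbidden [:: 1; 2; 2; 0] w.
  move=> H /zero_forbidden_1220P[x [y [sub x0 xy]]].
  move: (H x) (H y); rewrite !(mem_subseq sub) ?inE ?eqxx ?orbT //.
  by move=> /(_ isT) + /(_ isT); lia.
(* An occurrence of 122 ending in the new letter [a] would need an earlier [a], but all earlier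
   letters are at most [m < a]. *)
have append_up m a w : ~ zero_forbidden [:: 1; 2; 2; 0] w -> m \in w -> 0 < m ->
    {in w, forall x, x <= m} -> m < a -> free_pair [:: 1; 2; 2; 0] a (rcons w a).
  move=> allowed mw m0 le_m ma; split.
    by exists m; split=> //; apply: subseq_pair_rcons.
  case/zero_forbidden_1220P=> x [y [+ x0 xy]].
  rewrite (subseq_rcons_rcons _ [:: x; y]) => /orP[sub|/andP[/eqP-> sub]].
    by apply: allowed; apply/zero_forbidden_1220P; exists x, y.
  by have := le_m a (mem_subseq sub (mem_last _ [:: a])); rewrite leqNgt ma.
apply: (b_completions _ _ _ _ (free_pair [:: 1; 2; 2; 0])) => //.
- move=> m a w H m0 mw; apply: append_up => //; first exact: (unary_zero m).
  by move=> x /H; lia.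
- by move=> m w [].
- move=> m w [[x [x0 xm sub]] allowed] _; split.
    by exists x; split=> //; apply: subseq_rconsl.
  case/zero_forbidden_1220P=> y [u [+ y0 yu]].
  rewrite (subseq_rcons_rcons _ [:: y; u]) => /orP[sub'|/andP[/eqP u0 _]]; last by lia.
  by apply: allowed; apply/zero_forbidden_1220P; exists y, u.
- move=> m w [[x [x0 xm sub]] _] _; apply/zero_forbidden_1220P; exists x, m.
  by split=> //; rewrite (subseq_rcons_rcons _ [:: x; m]) eqxx sub orbT.
move=> m a w [[x [x0 xm sub]] allowed] le_m; apply: append_up => //; last by lia.
exact: (mem_subseq sub (mem_last _ [:: m])).
Qed.

(** The first zero after an increasing nonzero pair is allowed, but it forbids every later one. *)
Lemma b_1200 n : b n.+1 [:: 1; 2; 0; 0] = zero_completions Rigid Free Free n.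
Proof.
have unary_zero m w : {in w, forall x, (x == 0) || (x == m)} ->
    ~ zero_forbidden [:: 1; 2; 0; 0] w.
  move=> H /zero_forbidden_1200P[x [y [sub x0 xy]]].
  move: (H x) (H y); rewrite !(mem_subseq sub) ?inE ?eqxx ?orbT //.
  by move=> /(_ isT) + /(_ isT); lia.
have append_pos a w : 0 < a -> ~ zero_forbidden [:: 1; 2; 0; 0] w ->
    ~ zero_forbidden [:: 1; 2; 0; 0] (rcons w a).
  move=> a0 allowed /zero_forbidden_1200P[x [y [+ x0 xy]]].
  rewrite (subseq_rcons_rcons _ [:: x; y]) => /orP[sub|/andP[/eqP]]; last by lia.
  by apply: allowed; apply/zero_forbidden_1200P; exists x, y.
apply: (b_completions _ _ _ _ (free_pair [:: 1; 2; 0; 0])) => //.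
- move=> m a w H m0 mw ma; split; last by apply: append_pos; [lia|apply: unary_zero H].
  by exists m; split=> //; apply: subseq_pair_rcons.
- by move=> m w [].
- move=> m w [[x [x0 xm sub]] _] _; apply/zero_forbidden_1200P; exists x, m.
  by split=> //; rewrite (subseq_rcons_rcons _ [:: x; m]) eqxx sub orbT.
- move=> m w [[x [x0 xm sub]] allowed] _; split; last by apply: append_pos => //; lia.
  by exists x; split=> //; apply: subseq_rconsl.
move=> m a w [[x [x0 xm sub]] allowed] _ ma; split; last by apply: append_pos => //; lia.
exists m; split=> //; first by lia.
exact/subseq_pair_rcons/(mem_subseq sub (mem_last _ [:: m])).
Qed.

(** * Order 5 recurrences for the counts *)

Lemma zero_completions_rec_1230 n (z := zero_completions Free Free Rigid) :
  z n.+4.+1 + 23 * z n.+3 + 13 * z n.+1 = 8 * z n.+4 + 28 * z n.+2 + 2 * z n.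
Proof.
pose c := completions Free Free Rigid.
apply: (linear_rec_1230 (fun n => c n Rigid false) _ _
  (fun n => c n Free false) (fun n => c n Free true)
  (fun n => c n Unary false) (fun n => c n Unary true) z) => //;
  by move=> k s; rewrite /c /= ?addn0 ?addn1.
Qed.

(* After one more letter both sides of [swap] become the same sum, so the two ways
   of leaving phase [Free] are interchangeable. *)
Lemma completions_Free_1220 n s :
  completions Free Rigid Free n Free false s = completions Rigid Free Free n Free false s.
Proof.
have rigid k z r : completions Free Rigid Free k Rigid z r =
    completions Rigid Free Free k Rigid z r.
  elim: k z r => [|k IH] z r //=; rewrite IH; congr (_ + _).
  by apply: eq_prefix_sum => i; apply: IH.
pose c := completions Free Rigid Free.
have swap k r : c k Free true r + c k Rigid false r = c k Free false r + c k Rigid true r.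
  by rewrite /c; case: k => [|k] //=; rewrite !addn0 !addn1; lia.
elim: n s => [|n IH] s //.
have psum : prefix_sum (c n Free false) s =
    prefix_sum (completions Rigid Free Free n Free false) s.
  by apply: eq_prefix_sum => i; apply: IH.
by rewrite /= -psum !addn0 -!rigid -IH; have := swap n s; rewrite /c; lia.
Qed.

(** The phase parameters enter the recursions for [Unary] and for zero words only through
    [completions] in phase [Free] after a nonzero letter. *)
Lemma zero_completions_1220 n :
  zero_completions Free Rigid Free n = zero_completions Rigid Free Free n.
Proof.
have unary k z s : completions Free Rigid Free k Unary z s =
    completions Rigid Free Free k Unary z s.
  elim: k z s => [|k IH] z s //=; rewrite !IH; congr (_ + _ + _).
  by apply: eq_prefix_sum => i; apply: completions_Free_1220.
by elim: n => //= n ->; rewrite unary.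
Qed.

Lemma zero_completions_rec_1200 n (z := zero_completions Rigid Free Free) :
  z n.+4.+1 + 23 * z n.+3 + 13 * z n.+1 = 8 * z n.+4 + 28 * z n.+2 + 2 * z n.
Proof.
pose c := completions Rigid Free Free.
apply: (linear_rec_1200 (fun n => c n Rigid false) (fun n => c n Rigid true)
  _ _ _ _ (fun n => c n Free false)
  (fun n => c n Unary false) (fun n => c n Unary true) z) => //;
  by move=> k s; rewrite /c /= ?addn0 ?addn1.
Qed.

Local Open Scope ring_scope.

(** * Formal power series *)

Section Series.
Variable R : comUnitRingType.
Implicit Types u v w : fps R.

Definition truncate (n : nat) u : {poly R} := \poly_(i < n.+1) u i.

Lemma fps_mul_truncate n m u v : (n <= m)%N ->
  fps_mul u v n = (truncate m u * truncate m v)`_n.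
Proof.
move=> le_nm; rewrite coefM; apply: eq_bigr => i _.
have le_in : (i <= n)%N by rewrite -ltnS.
by rewrite !coef_poly !ltnS (leq_trans le_in le_nm) (leq_trans (leq_subr _ _) le_nm).
Qed.

(** Coefficients up to degree [n] depend only on truncations, so associativity is inherited from
    polynomials. *)
Lemma fps_mulA u v w : fps_mul u (fps_mul v w) =1 fps_mul (fps_mul u v) w.
Proof.
move=> n; transitivity ((truncate n u * (truncate n v * truncate n w))`_n).
  rewrite coefM; apply: eq_bigr => i _.
  have le_in : (i <= n)%N by rewrite -ltnS.
  by rewrite coef_poly ltnS le_in (@fps_mul_truncate _ n) // leq_subr.
rewrite mulrA coefM; apply: eq_bigr => i _.
have le_in : (i <= n)%N by rewrite -ltnS.
by rewrite [in RHS](@fps_mul_truncate _ n) // coef_poly ltnS leq_subr.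
Qed.

Lemma eq_fps_mul u u' v v' : u =1 u' -> v =1 v' -> fps_mul u v =1 fps_mul u' v'.
Proof. by move=> eu ev n; apply: eq_bigr => i _; rewrite eu ev. Qed.

Lemma fps_mulr1 u : fps_mul u (fps_of_poly 1) =1 u.
Proof.
move=> n; rewrite /fps_mul /fps_of_poly big_ord_recr /= subnn coef1 mulr1.
by rewrite big1 ?add0r // => i _; rewrite coef1 subn_eq0 leqNgt ltn_ord mulr0.
Qed.

Lemma fps_div_unique u p q : q 0%N \is a GRing.unit ->
  fps_mul u q =1 p -> u =1 fps_div p q.
Proof.
move=> q0 uq n; rewrite /fps_div -(eq_fps_mul _ _ _ _ uq (fun=> erefl)) -fps_mulA.
by rewrite (eq_fps_mul u u _ _ (fun=> erefl) (fps_mulV q0)) fps_mulr1.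
Qed.

End Series.

(** * The rational generating function *)

Lemma denominatorE :
  ((1 - 2 *: 'X) * (1 - 3 *: 'X + 'X^2) ^+ 2 : {poly int}) =
  Poly [:: 1; -8; 23; -28; 13; -2].
Proof. by rewrite /= !cons_poly_def -!mul_polyC; ring. Qed.

Lemma numeratorE :
  (1 - 7 *: 'X + 17 *: 'X^2 - 16 *: 'X^3 + 5 *: 'X^4 - 'X^5 : {poly int}) =
  Poly [:: 1; -7; 17; -16; 5; -1].
Proof. by rewrite /= !cons_poly_def -!mul_polyC; ring. Qed.

(** The recurrence for [z] governs the coefficients of the product from degree 6 on; the lower
    degrees also involve [u 0] or fewer terms and produce the numerator. *)
Lemma zero_completions_series (z : nat -> nat) (u : fps int) :
  (forall n, z n.+4.+1 + 23 * z n.+3 + 13 * z n.+1 = 8 * z n.+4 + 28 * z n.+2 + 2 * z n)%N ->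
  [seq z n | n <- iota 0 5] = [:: 1; 2; 5; 14; 41]%N ->
  u 0%N = 1 -> (forall n, u n.+1 = (z n)%:Z) ->
  fps_mul u (fps_of_poly (Poly [:: 1; -8; 23; -28; 13; -2])) =1
  fps_of_poly (Poly [:: 1; -7; 17; -16; 5; -1]).
Proof.
move=> z_rec [z0 z1 z2 z3 z4] u0 uS n; rewrite /fps_mul /fps_of_poly.
under eq_bigr do rewrite coef_Poly.
rewrite coef_Poly.
case: n => [|[|[|[|[|[|n]]]]]];
  try by rewrite !big_ord_recr big_ord0 /= ?u0 ?uS ?z0 ?z1 ?z2 ?z3 ?z4; lia.
(* Reversal puts the six denominator coefficients first; all further ones are the default 0 of
   [nth]. *)
rewrite (reindex_inj rev_ord_inj) /=.
under eq_bigr => i _ do rewrite subSS subKn -1?ltnS ?ltn_ord //.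
rewrite 6!big_ord_recl big1 /=.
  by rewrite !subSS !subn0 !uS nth_nil; move: (z_rec n); lia.
by move=> i _; rewrite /= !nth_nil mulr0.
Qed.

Theorem theorem2p10 (tau : seq nat)
    (htau : tau \in [:: [:: 1; 2; 0; 0]; [:: 1; 2; 2; 0]; [:: 1; 2; 3; 0]]%N) :
  f tau =1
  fps_div
    (fps_of_poly (1 - 7 *: 'X + 17 *: 'X^2 - 16 *: 'X^3 + 5 *: 'X^4 - 'X^5))
    (fps_of_poly ((1 - 2 *: 'X) * (1 - 3 *: 'X + 'X^2) ^+ 2)).
Proof.
have f0 : f tau 0 = 1.
  by rewrite /f b_suffixes; last by move: htau; rewrite !inE => /or3P[] /eqP->.
rewrite numeratorE denominatorE.
apply: fps_div_unique; first by rewrite /fps_of_poly coef_Poly.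
move: htau f0; rewrite !inE => /or3P[] /eqP-> f0.
- apply: zero_completions_series f0 _ => [||n]; first exact: zero_completions_rec_1200.
    by [].
  by rewrite /f b_1200.
- apply: zero_completions_series f0 _ => [||n]; first exact: zero_completions_rec_1200.
    by [].
  by rewrite /f b_1220 zero_completions_1220.
- apply: zero_completions_series f0 _ => [||n]; first exact: zero_completions_rec_1230.
    by [].
  by rewrite /f b_1230.
Qed.
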